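(* Let $((G,\pi_G),(G^*,\pi_{G^*}))$ be a pair of dual Poisson Lie groups contained as subgroups in a Drinfeld double $D$, and assume $(G,\pi_G)$ is complete, i.e. multiplication in $D$ is a diffeomorphism $G\times G^*\to D$. Let $$\mathcal R=\{((uv,\,uk),\ (u[k]^{-1}u,\ u[k]^{-1}g)):\ g,k\in G,\ u,v\in G^*\}\subset D^2\times D^2$$ be the global $\mathcal R$-matrix of $(D^2,\pi^+_{D^2})$, let $\Psi:D\times D\to D^2$ be the diffeomorphism $$\Psi(g_1u_1,g_2u_2)=(g_1u_1u_2,\ g_1g_2u_2),\qquad g_i\in G,\ u_i\in G^*,$$ and let $\iota_{G^*}:D\to D$ be the inverse map of the groupoid $D_{G^*}\rightrightarrows G^*$. Then $$(\mathrm{Id}_D\times\iota_{G^*}\times\mathrm{Id}_D\times\iota_{G^*})(\Psi^{-1}\times\Psi^{-1})(\mathcal R)=G^*\times D_{\mathrm{diag}}\times G\ \subset D^4,$$ where $D_{\mathrm{diag}}\subset D\times D$ is the diagonal, occupying the second and third factors.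
   Context: A pair of dual Poisson Lie groups is a pair of Poisson Lie groups whose Lie bialgebras $(\mathfrak g,\delta_{\mathfrak g})$, $(\mathfrak g^*,\delta_{\mathfrak g^*})$ are dual. The double Lie algebra is $\mathfrak d=\mathfrak g\oplus\mathfrak g^*$ with the form $\langle x+\xi,y+\eta\rangle=\langle x,\eta\rangle+\langle y,\xi\rangle$ and the unique Lie bracket for which $\mathfrak g,\mathfrak g^*$ are subalgebras and the form is ad-invariant; a Drinfeld double is a Lie group $D$ with Lie algebra $\mathfrak d$, and $G,G^*$ are assumed to be subgroups of $D$. When $(G,\pi_G)$ is complete, each $d\in D$ is uniquely $d=gu=u'g'$ with $g,g'\in G$, $u,u'\in G^*$. For $u\in G^*$ and $k\in G$, $u[k]\in G$ and $u^k\in G^*$ denote the elements with $uk=u[k]\,u^k$. $D_{G^*}$ denotes $D$ as a groupoid over $G^*$: for $d=gu=u'g'$ the source is $u$ and the target $u'$; if $d_i=g_iu_i=u_i'g_i'$ and $u_1'=u_2$ then $d_1\star d_2=g_2g_1u_1$; the inverse is $\iota_{G^*}(d)=g^{-1}u'$. Here $D^2=D\times D$ carries the Poisson structure $\pi^+_{D^2}$ of the double symplectic groupoid associated to the Poisson Lie group $D\cong D_{\mathrm{diag}}$ and its dual $G^*\times G\subset D^2$; only the explicit set $\mathcal R$ enters the statement. The factors $G^*$ and $G$ on the right-hand side are regarded as subsets of $D$. *)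

(* Defs.v *)
From HB Require Import structures.
From mathcomp Require Import all_boot all_order all_algebra.
From mathcomp Require Import all_classical all_reals all_analysis.

Set Implicit Arguments.
Unset Strict Implicit.
Unset Printing Implicit Defensive.

Import Order.TTheory GRing.Theory Num.Theory.
Import numFieldNormedType.Exports.

Local Open Scope classical_set_scope.
Local Open Scope ring_scope.

(** * Smooth manifolds *)

(** [Ck k U f]: [f] is of class C^k on [U], for [U] open. *)
Fixpoint Ck (R : realType) (n : nat) (V : normedModType R) (k : nat)
    (U : set 'rV[R]_n) (f : 'rV[R]_n -> V) : Prop :=
  if k is k'.+1 then
    (forall x, U x -> differentiable f x) /\
    (forall i : 'I_n, Ck k' U (fun x => 'D_(delta_mx 0 i) f x))
  else forall x, U x -> {for x, continuous f}.

Definition smooth_on (R : realType) (n : nat) (V : normedModType R)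
    (U : set 'rV[R]_n) (f : 'rV[R]_n -> V) : Prop :=
  forall k, Ck k U f.

(** Only the values of [chart_map] on [chart_dom], and of [chart_inv] on the
    image of [chart_dom], are meaningful. *)
Record chart (R : realType) (n : nat) (M : topologicalType) := Chart {
  chart_dom : set M;
  chart_map : M -> 'rV[R]_n;
  chart_inv : 'rV[R]_n -> M }.

Definition chart_im (R : realType) (n : nat) (M : topologicalType)
    (c : chart R n M) : set 'rV[R]_n :=
  chart_map c @` chart_dom c.

Definition is_chart (R : realType) (n : nat) (M : topologicalType)
    (c : chart R n M) : Prop :=
  [/\ open (chart_dom c), open (chart_im c),
      (forall x, chart_dom c x -> chart_inv c (chart_map c x) = x),
      {within chart_dom c, continuous (chart_map c)} &
      {within chart_im c, continuous (chart_inv c)}].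

Definition is_atlas (R : realType) (n : nat) (M : topologicalType)
    (A : set (chart R n M)) : Prop :=
  [/\ (forall c, A c -> is_chart c),
      (forall x, exists2 c, A c & chart_dom c x) &
      (forall c c', A c -> A c' ->
        smooth_on (chart_map c @` (chart_dom c `&` chart_dom c'))
                  (chart_map c' \o chart_inv c))].

Definition smooth_map (R : realType) (m n : nat) (M N : topologicalType)
    (A : set (chart R m M)) (B : set (chart R n N)) (F : M -> N) : Prop :=
  continuous F /\
  forall c c', A c -> B c' ->
    smooth_on (chart_map c @` (chart_dom c `&` F @^-1` chart_dom c'))
              (chart_map c' \o F \o chart_inv c).

Definition diffeomorphism (R : realType) (m n : nat) (M N : topologicalType)
    (A : set (chart R m M)) (B : set (chart R n N)) (F : M -> N) : Prop :=
  smooth_map A B F /\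
  exists F' : N -> M, [/\ cancel F F', cancel F' F & smooth_map B A F'].

Definition prod_chart (R : realType) (m n : nat) (M N : topologicalType)
    (c : chart R m M) (c' : chart R n N) : chart R (m + n) (M * N)%type :=
  Chart (chart_dom c `*` chart_dom c')
    (fun p => row_mx (chart_map c p.1) (chart_map c' p.2))
    (fun x => (chart_inv c (lsubmx x), chart_inv c' (rsubmx x))).

Definition prod_atlas (R : realType) (m n : nat) (M N : topologicalType)
    (A : set (chart R m M)) (B : set (chart R n N))
    : set (chart R (m + n) (M * N)%type) :=
  [set c | exists c1 c2, [/\ A c1, B c2 & c = prod_chart c1 c2]].

HB.mixin Record Topological_isManifold (R : realType) (n : nat) M
    of Topological M := {
  atlas : set (chart R n M);
  atlasP : is_atlas atlas;
  manifold_hausdorff : hausdorff_space M;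
  manifold_second_countable : @second_countable M }.

#[short(type="manifoldType")]
HB.structure Definition Manifold (R : realType) (n : nat) :=
  { M of Topological M & Topological_isManifold R n M }.

Arguments atlas {R n} s.

HB.mixin Record Manifold_isLieGroup (R : realType) (n : nat) G
    of Manifold R n G & Group G := {
  smooth_mulg : smooth_map (prod_atlas (atlas G) (atlas G)) (atlas G)
    (fun p : G * G => (p.1 * p.2)%g);
  smooth_invg : smooth_map (atlas G) (atlas G) (fun g : G => (g^-1)%g) }.

#[short(type="lieGroupType")]
HB.structure Definition LieGroup (R : realType) (n : nat) :=
  { G of Manifold R n G & Group G & Manifold_isLieGroup R n G }.

(** * Smooth functions, tangent vectors and Poisson structures *)

Definition smooth_fun (R : realType) (n : nat) (M : manifoldType R n)
    (f : M -> R) : Prop :=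
  forall c, atlas M c -> smooth_on (chart_im c) (f \o chart_inv c : _ -> R^o).

(** Tangent vectors are derivations of the algebra of smooth functions.  They
    are extended by [0] to the functions which are not smooth, so that two
    tangent vectors are equal as soon as they agree on smooth functions. *)
Definition tangent (R : realType) (n : nat) (M : manifoldType R n) (p : M)
    : set ((M -> R) -> R) :=
  [set v | [/\ (forall (a : R) f h, smooth_fun f -> smooth_fun h ->
                  v (fun x => a * f x + h x) = a * v f + v h),
               (forall f h, smooth_fun f -> smooth_fun h ->
                  v (fun x => f x * h x) = v f * h p + f p * v h) &
               (forall f, ~ smooth_fun f -> v f = 0)]].

Definition tangent_map (R : realType) (m n : nat) (M : manifoldType R m)
    (N : manifoldType R n) (F : M -> N) (v : (M -> R) -> R)
    : (N -> R) -> R :=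
  fun f => if `[< smooth_fun f >] then v (f \o F) else 0.

(** A Poisson structure, given by its bracket {f, h} = pi(df, dh); only the
    values of the bracket on smooth functions are meaningful. *)
Record poisson (R : realType) (n : nat) (M : manifoldType R n) := Poisson {
  pbracket :> (M -> R) -> (M -> R) -> M -> R;
  pbracket_smooth : forall f h, smooth_fun f -> smooth_fun h ->
    smooth_fun (pbracket f h);
  pbracket_antisym : forall f h, smooth_fun f -> smooth_fun h ->
    forall x, pbracket f h x = - pbracket h f x;
  pbracket_linear : forall (a : R) f1 f2 h,
    smooth_fun f1 -> smooth_fun f2 -> smooth_fun h ->
    forall x, pbracket (fun y => a * f1 y + f2 y) h x
              = a * pbracket f1 h x + pbracket f2 h x;
  pbracket_leibniz : forall f1 f2 h,
    smooth_fun f1 -> smooth_fun f2 -> smooth_fun h ->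
    forall x, pbracket (fun y => f1 y * f2 y) h x
              = f1 x * pbracket f2 h x + pbracket f1 h x * f2 x;
  pbracket_jacobi : forall f1 f2 f3,
    smooth_fun f1 -> smooth_fun f2 -> smooth_fun f3 ->
    forall x, pbracket f1 (pbracket f2 f3) x + pbracket f2 (pbracket f3 f1) x
              + pbracket f3 (pbracket f1 f2) x = 0 }.

(** * Poisson Lie groups, duality and Drinfeld doubles *)

(** Lie(G), as the tangent space at the unit; [lie_bracket] is the commutator
    of the left invariant vector fields
    (x^L f)(g) = x (f \o (left translation by g)). *)
Definition lie_algebra (R : realType) (n : nat) (G : lieGroupType R n)
    : set ((G -> R) -> R) :=
  tangent (1%g : G).

Definition lie_bracket (R : realType) (n : nat) (G : lieGroupType R n)
    (x y : (G -> R) -> R) : (G -> R) -> R :=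
  fun f => if `[< smooth_fun f >] then
      x (fun g => y (fun h => f (g * h)%g))
      - y (fun g => x (fun h => f (g * h)%g))
    else 0.

(** The multiplication G x G -> G is a Poisson map, with the product Poisson
    structure on G x G. *)
Definition poisson_lie (R : realType) (n : nat) (G : lieGroupType R n)
    (pi : poisson G) : Prop :=
  forall f h, smooth_fun f -> smooth_fun h -> forall g k : G,
    pi f h (g * k)%g
    = pi (fun x => f (x * k)%g) (fun x => h (x * k)%g) g
      + pi (fun x => f (g * x)%g) (fun x => h (g * x)%g) k.

(** The cobracket of the Lie bialgebra of [(G, pi)], i.e. the linearization of
    [pi] at the unit: the value of delta(x) on the pair of covectors
    (d_e f, d_e h) is x {f, h}. *)
Definition cobracket (R : realType) (n : nat) (G : lieGroupType R n)
    (pi : poisson G) (x : (G -> R) -> R) (f h : G -> R) : R :=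
  x (pi f h).

Definition dual_pairing (R : realType) (n : nat) (G Gs : lieGroupType R n)
    (B : ((G -> R) -> R) -> ((Gs -> R) -> R) -> R) : Prop :=
  [/\ (forall (a : R) x y xi, lie_algebra x -> lie_algebra y ->
         lie_algebra xi ->
         B (fun f => a * x f + y f) xi = a * B x xi + B y xi),
      (forall (a : R) x xi eta, lie_algebra x -> lie_algebra xi ->
         lie_algebra eta ->
         B x (fun f => a * xi f + eta f) = a * B x xi + B x eta),
      (forall x, lie_algebra x ->
         (forall xi, lie_algebra xi -> B x xi = 0) -> x = (fun=> 0)) &
      (forall xi, lie_algebra xi ->
         (forall x, lie_algebra x -> B x xi = 0) -> xi = (fun=> 0))].

(** [B] identifies Lie(Gs) with the dual of Lie(G) in such a way that the
    bracket of Lie(Gs) is the transpose of the cobracket of Lie(G): here the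
    covectors [xi] and [eta] are the differentials of [f] and [h] at the
    unit. *)
Definition cobracket_dual (R : realType) (n : nat) (G Gs : lieGroupType R n)
    (pi : poisson G) (B : ((G -> R) -> R) -> ((Gs -> R) -> R) -> R) : Prop :=
  forall f h xi eta, smooth_fun f -> smooth_fun h ->
    lie_algebra xi -> lie_algebra eta ->
    (forall x, lie_algebra x -> x f = B x xi) ->
    (forall x, lie_algebra x -> x h = B x eta) ->
    forall x, lie_algebra x -> cobracket pi x f h = B x (lie_bracket xi eta).

Definition dual_poisson_lie_groups (R : realType) (n : nat)
    (G Gs : lieGroupType R n) (piG : poisson G) (piGs : poisson Gs)
    (B : ((G -> R) -> R) -> ((Gs -> R) -> R) -> R) : Prop :=
  [/\ poisson_lie piG, poisson_lie piGs, dual_pairing B,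
      cobracket_dual piG B & cobracket_dual piGs (fun xi x => B x xi)].

Definition lie_subgroup (R : realType) (m n : nat) (H : lieGroupType R m)
    (D : lieGroupType R n) (i : H -> D) : Prop :=
  [/\ {morph i : x y / (x * y)%g >-> (x * y)%g}, injective i &
      smooth_map (atlas H) (atlas D) i].

(** The groups [G] and [Gs], included in [D] by [i] and [j], are Lie subgroups
    of the Lie group [D], and Lie(D) is the double Lie algebra
    Lie(G) (+) Lie(Gs), with its canonical ad-invariant form [form]. That Lie(G)
    and Lie(Gs) are Lie subalgebras holds because [i] and [j] are morphisms. *)
Definition drinfeld_double (R : realType) (n : nat) (G Gs : lieGroupType R n)
    (B : ((G -> R) -> R) -> ((Gs -> R) -> R) -> R)
    (D : lieGroupType R (n + n)) (i : G -> D) (j : Gs -> D) : Prop :=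
  let sum x xi := fun f => tangent_map i x f + tangent_map j xi f in
  [/\ lie_subgroup i, lie_subgroup j,
      (forall z, lie_algebra z -> exists! p,
         [/\ lie_algebra p.1, lie_algebra p.2 & z = sum p.1 p.2]) &
      exists form : ((D -> R) -> R) -> ((D -> R) -> R) -> R,
        (forall x y xi eta, lie_algebra x -> lie_algebra y ->
           lie_algebra xi -> lie_algebra eta ->
           form (sum x xi) (sum y eta) = B x eta + B y xi) /\
        (forall a b c, lie_algebra a -> lie_algebra b -> lie_algebra c ->
           form (lie_bracket a b) c + form b (lie_bracket a c) = 0)].

(** Completeness of [(G, piG)]. *)
Definition complete_in (R : realType) (n : nat) (G Gs : lieGroupType R n)
    (D : lieGroupType R (n + n)) (i : G -> D) (j : Gs -> D) : Prop :=
  diffeomorphism (prod_atlas (atlas G) (atlas Gs)) (atlas D)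
    (fun p : G * Gs => (i p.1 * j p.2)%g).

(** * Factorizations in the double *)

Section Factorization.
Context (D G Gs : groupType) (i : G -> D) (j : Gs -> D).
Local Open Scope group_scope.

(** [(g, u)] with d = gu, respectively [(u', g')] with d = u'g'; meaningful
    when these exist and are unique. *)
Definition factGU (d : D) : G * Gs :=
  xget (1, 1) [set p : G * Gs | i p.1 * j p.2 = d].

Definition factUG (d : D) : Gs * G :=
  xget (1, 1) [set p : Gs * G | j p.1 * i p.2 = d].

(** u[k] and u^k. *)
Definition dressl (u : Gs) (k : G) : G := (factGU (j u * i k)).1.
Definition dressr (u : Gs) (k : G) : Gs := (factGU (j u * i k)).2.

(** The groupoid D_{G^*}. *)
Definition gpd_src (d : D) : Gs := (factGU d).2.
Definition gpd_tgt (d : D) : Gs := (factUG d).1.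
Definition gpd_mul (d1 d2 : D) : D :=
  i (factGU d2).1 * i (factGU d1).1 * j (factGU d1).2.
Definition gpd_inv (d : D) : D := (i (factGU d).1)^-1 * j (factUG d).1.

Definition Rmatrix : set ((D * D) * (D * D)) :=
  [set p | exists (g k : G) (u v : Gs),
    p = ((j u * j v, j u * i k),
         ((i (dressl u k))^-1 * j u, (i (dressl u k))^-1 * i g))].

Definition Psi (p : D * D) : D * D :=
  let: (g1, u1) := factGU p.1 in
  let: (g2, u2) := factGU p.2 in
  (i g1 * j u1 * j u2, i g1 * i g2 * j u2).

Definition Psi_inv (q : D * D) : D * D := xget (1, 1) [set p | Psi p = q].

(** The lemmas below check that, for group inclusions whose product map
    G x G^* -> D is bijective, the above are what their names say. *)
Hypothesis iM : {morph i : x y / x * y}.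
Hypothesis jM : {morph j : x y / x * y}.
Hypothesis mul_bij : bijective (fun p : G * Gs => i p.1 * j p.2).

Let morph1 (H : groupType) (f : H -> D) :
  {morph f : x y / x * y} -> f 1 = 1.
Proof. by move=> fM; apply: (mulgI (f 1)); rewrite -fM !mulg1. Qed.

Let morphV (H : groupType) (f : H -> D) :
  {morph f : x y / x * y} -> {morph f : x / x^-1}.
Proof.
move=> fM x; apply: (mulgI (f x)).
by rewrite -fM !mulgV morph1.
Qed.

Let i1 := morph1 iM.
Let j1 := morph1 jM.
Let iV := morphV iM.
Let jV := morphV jM.

Lemma factGUK d : i (factGU d).1 * j (factGU d).2 = d.
Proof.
have [f fK Kf] := mul_bij.
by rewrite /factGU; case: xgetP => [p _ //|] /(_ (f d)) []; exact: Kf.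
Qed.

Lemma factGUE g u : factGU (i g * j u) = (g, u).
Proof.
have := factGUK (i g * j u); set p := factGU _ => e.
exact: (@bij_inj _ _ _ mul_bij p (g, u) e).
Qed.

Lemma factUGK d : j (factUG d).1 * i (factUG d).2 = d.
Proof.
rewrite /factUG; case: xgetP => [p _ //|].
move=> /(_ ((factGU d^-1).2^-1, (factGU d^-1).1^-1)) [] /=.
by rewrite iV jV -invgM factGUK invgK.
Qed.

Lemma factUGE u g : factUG (j u * i g) = (u, g).
Proof.
have := factUGK (j u * i g); case: factUG => u' g' /= e.
have := congr1 (fun x : D => x^-1) e; rewrite !invgM -!iV -!jV => /(congr1 factGU).
rewrite !factGUE => -[eg eu].
by rewrite -(invgK u') eu -(invgK g') eg !invgK.
Qed.

Lemma dressE u k : j u * i k = i (dressl u k) * j (dressr u k).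
Proof. by rewrite factGUK. Qed.

Lemma gpd_srcV d : gpd_src (gpd_inv d) = gpd_tgt d.
Proof. by rewrite /gpd_src /gpd_inv -iV factGUE. Qed.

Lemma gpd_invE d : gpd_inv d = j (factGU d).2 * (i (factUG d).2)^-1.
Proof.
rewrite /gpd_inv; apply: (mulgI (i (factGU d).1)); rewrite mulVKg mulgA.
by rewrite factGUK -[X in _ = X / _](factUGK d) mulgK.
Qed.

Lemma gpd_tgtV d : gpd_tgt (gpd_inv d) = gpd_src d.
Proof. by rewrite gpd_invE /gpd_tgt -iV factUGE. Qed.

Lemma gpd_mulV d : gpd_mul d (gpd_inv d) = j (gpd_src d).
Proof. by rewrite /gpd_mul /gpd_inv -!iV !factGUE -iM mulVg i1 mul1g. Qed.

Lemma gpd_mulVl d : gpd_mul (gpd_inv d) d = j (gpd_tgt d).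
Proof. by rewrite /gpd_mul /gpd_inv -!iV !factGUE -iM mulgV i1 mul1g. Qed.

Lemma Psi_bij : bijective Psi.
Proof.
exists (fun q => let: (g1, w) := factGU q.1 in
          let: (g2, u2) := factGU ((i g1)^-1 * q.2) in
          (i g1 * j (w * u2^-1), i g2 * j u2)) => -[d1 d2] /=.
- rewrite /Psi /=; case E1 : (factGU d1) => [g1 u1] /=.
  case E2 : (factGU d2) => [g2 u2] /=.
  rewrite -mulgA -jM factGUE -mulgA mulKg factGUE mulgK.
  by rewrite -(factGUK d1) -(factGUK d2) E1 E2.
- case E1 : (factGU d1) => [g1 u1] /=.
  case E2 : (factGU _) => [g2 u2] /=.
  rewrite /Psi /= !factGUE -mulgA -jM mulgVK.
  have := factGUK d1; rewrite E1 /= => ->.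
  by have := factGUK ((i g1)^-1 * d2); rewrite E2 /= -mulgA => ->; rewrite mulVKg.
Qed.

Lemma Psi_invK : cancel Psi_inv Psi.
Proof.
have [f fK Kf] := Psi_bij => q.
by rewrite /Psi_inv; case: xgetP => [p _ //|] /(_ (f q)) []; exact: Kf.
Qed.

Lemma PsiK : cancel Psi Psi_inv.
Proof. by move=> p; apply: (bij_inj Psi_bij); rewrite Psi_invK. Qed.

End Factorization.

(* Main.v *)
Require Import Defs.
From mathcomp Require Import all_boot all_order all_algebra.
From mathcomp Require Import all_classical all_reals all_analysis.

Local Open Scope classical_set_scope.

(** Put [a = u[k]].  From [uk = a u^k] one reads off
    [Psi^-1 (uv, uk) = (uv(u^k)^-1, uk)] and [Psi^-1 (a^-1 u, a^-1 g) = (a^-1 u, g)],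
    while [iota (uk) = a^-1 u] and [iota g = g^-1].  So the image of [Rmatrix]
    consists of the points [(uv(u^k)^-1, a^-1 u, a^-1 u, g^-1)].  The outer
    entries are arbitrary, through [v] and [g]; every [d] in [D] is [a^-1 u] for
    a suitable [k], obtained by factorizing [d^-1 = k s]. *)

Section Factorization.
Context (D G Gs : groupType) (i : G -> D) (j : Gs -> D).
Local Open Scope group_scope.
Hypothesis iM : {morph i : x y / x * y}.
Hypothesis jM : {morph j : x y / x * y}.
Hypothesis mul_bij : bijective (fun p : G * Gs => i p.1 * j p.2).

Lemma morph_mulg1 {H : groupType} {f : H -> D} :
  {morph f : x y / x * y} -> f 1 = 1.
Proof. by move=> fM; apply: (mulgI (f 1)); rewrite -fM !mulg1. Qed.

Lemma morph_mulgV {H : groupType} {f : H -> D} :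
  {morph f : x y / x * y} -> {morph f : x / x^-1}.
Proof.
by move=> fM x; apply: (mulgI (f x)); rewrite -fM !mulgV morph_mulg1.
Qed.

Lemma PsiE g1 u1 g2 u2 :
  Psi i j (i g1 * j u1, i g2 * j u2) = (i g1 * j u1 * j u2, i g1 * i g2 * j u2).
Proof. by rewrite /Psi !(factGUE mul_bij). Qed.

(** As [uk = u[k] u^k], a pair [(w, uk)] with [w] in [Gs], whose first entry has trivial [G]-part,
    goes under [Psi] to [(w u^k, uk)]; matching [w u^k = uv] fixes [w]. *)
Lemma Psi_inv_Rmatrix1 (u v : Gs) (k : G) :
  Psi_inv i j (j u * j v, j u * i k)
  = (j (u * v * (dressr i j u k)^-1), j u * i k).
Proof.
apply: (canLR (PsiK jM mul_bij)); rewrite (dressE mul_bij).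
rewrite -[X in Psi _ _ (X, _)]mul1g -(morph_mulg1 iM) PsiE.
by rewrite (morph_mulg1 iM) !mul1g -!jM mulgVK.
Qed.

(** When the second entry [g] has trivial [Gs]-part, [Psi] keeps the first entry [a^-1 u] and
    multiplies [g] on the left by [a^-1]. *)
Lemma Psi_inv_Rmatrix2 (u : Gs) (a g : G) :
  Psi_inv i j ((i a)^-1 * j u, (i a)^-1 * i g) = ((i a)^-1 * j u, i g).
Proof.
apply: (canLR (PsiK jM mul_bij)).
rewrite -[X in Psi _ _ (_, X)]mulg1 -(morph_mulg1 jM) -(morph_mulgV iM) PsiE.
by rewrite (morph_mulg1 jM) !mulg1.
Qed.

(** The target of [uk] is visibly [u], while [u[k]] is by definition its [G]-part. *)
Lemma gpd_inv_mulUG (u : Gs) (k : G) :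
  gpd_inv i j (j u * i k) = (i (dressl i j u k))^-1 * j u.
Proof. by rewrite /gpd_inv (factUGE iM jM mul_bij). Qed.

Lemma gpd_invG (g : G) : gpd_inv i j (i g) = i g^-1.
Proof.
rewrite (gpd_invE iM jM mul_bij).
(* Both factorizations [g = g * 1 = 1 * g] have trivial [Gs]-part. *)
rewrite -[in factGU _ _ _](mulg1 (i g)) -(morph_mulg1 jM) (factGUE mul_bij).
rewrite -[in factUG _ _ _](mul1g (i g)) -(morph_mulg1 jM).
by rewrite (factUGE iM jM mul_bij) /= (morph_mulg1 jM) mul1g (morph_mulgV iM).
Qed.

Lemma dressl_surj (d : D) :
  exists (u : Gs) (k : G), (i (dressl i j u k))^-1 * j u = d.
Proof.
have ed := factGUK mul_bij d; have eV := factGUK mul_bij d^-1.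
case: (factGU i j d) ed => a u /= ed; case: (factGU i j d^-1) eV => k s /= eV.
(* Here [a] is the [G]-part of [d = au]. From [d d^-1 = a u k s = 1] comes [uk = a^-1 s^-1], so
   [u[k] = a^-1]. *)
exists u, k; have -> : dressl i j u k = a^-1.
  rewrite /dressl (_ : j u * i k = i a^-1 * j s^-1) ?(factGUE mul_bij) //.
  rewrite (morph_mulgV iM) (morph_mulgV jM); apply: (mulgI (i a)).
  by rewrite mulgA ed mulVKg; apply: (mulIg (j s)); rewrite -mulgA eV mulgV mulVg.
by rewrite (morph_mulgV iM) invgK.
Qed.

Lemma image_Rmatrix :
  (fun p : (D * D) * (D * D) =>
     ((p.1.1, gpd_inv i j p.1.2), (p.2.1, gpd_inv i j p.2.2))) @`
    ((fun p : (D * D) * (D * D) => (Psi_inv i j p.1, Psi_inv i j p.2)) @`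
       Rmatrix i j)
  = [set p : (D * D) * (D * D) |
      [/\ range j p.1.1, p.1.2 = p.2.1 & range i p.2.2]].
Proof.
rewrite image_comp; apply/seteqP; split => [_ [_ [g [k [u [v ->]]]] <-]|].
  rewrite /= Psi_inv_Rmatrix1 Psi_inv_Rmatrix2 /= gpd_inv_mulUG gpd_invG.
  by split=> //; [exists (u * v * (dressr i j u k)^-1) | exists g^-1].
move=> [[_ d] [_ _]] /= [[w _ <-] <- [h _ <-]].
have [u [k <-]] := dressl_surj d.
(* This solves [u v (u^k)^-1 = w]; the last entry [g^-1 = h] likewise forces [g = h^-1]. *)
pose v := u^-1 * w * dressr i j u k.
exists ((j u * j v, j u * i k),
        ((i (dressl i j u k))^-1 * j u, (i (dressl i j u k))^-1 * i h^-1)).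
  by exists h^-1, k, u, v.
rewrite /= Psi_inv_Rmatrix1 Psi_inv_Rmatrix2 /= gpd_inv_mulUG gpd_invG invgK.
by rewrite /v !mulgA mulgK mulgV mul1g.
Qed.

End Factorization.

Theorem lemma4p2 (R : realType) (n : nat) (G Gs : lieGroupType R n)
  (piG : poisson G) (piGs : poisson Gs)
  (B : ((G -> R) -> R) -> ((Gs -> R) -> R) -> R)
  (D : lieGroupType R (n + n)) (i : G -> D) (j : Gs -> D)
  (hdual : dual_poisson_lie_groups piG piGs B)
  (hdouble : drinfeld_double B i j)
  (hcomplete : complete_in i j) :
  (fun p : (D * D) * (D * D) =>
     ((p.1.1, gpd_inv i j p.1.2), (p.2.1, gpd_inv i j p.2.2))) @`
    ((fun p : (D * D) * (D * D) => (Psi_inv i j p.1, Psi_inv i j p.2)) @`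
       Rmatrix i j)
  = [set p : (D * D) * (D * D) |
      [/\ range j p.1.1, p.1.2 = p.2.1 & range i p.2.2]].
Proof.
have [[iM _ _] [jM _ _] _ _] := hdouble.
have [_ [F [FK KF _]]] := hcomplete.
exact: image_Rmatrix iM jM (Bijective FK KF).
Qed.
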